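(* Let $$w_n = Pw_{n-1}+\triangle t_n (Q_n+RE_{1,n})F(w_{n-1})+\triangle t_n RE_2F(w_n),\qquad n\ge 1,$$ be an $s$-stage explicit Peer method with variable step sizes (as described in the context) having stage order $s$, and suppose that the global error $\varepsilon_n=w(t_n)-w_n$ satisfies the estimate $$\|\varepsilon_n\|\le K\|\varepsilon_0\|+K\left(\triangle t_1^{s+1}\|d_{1,s+1}+Rl_{1,s}\|_\infty+\ldots+\triangle t_n^{s+1}\|d_{n,s+1}+Rl_{n,s}\|_\infty\right)\max_{0\le t\le t_n}\|u^{(s+1)}(t)\|+\mathcal{O}(\triangle t_{max}^{s+1})$$ with $\|\varepsilon_0\|=\mathcal{O}(\triangle t_0^{s+1})$. Let $\triangle t_{i-1}=(1+\mathcal{O}(\triangle t_{max}))\triangle t_i$ for all $i=1,\ldots,n$. Then the method is convergent of order $p=s+1$, i.e., $\varepsilon_n=\mathcal{O}(\triangle t_{max}^{s+1})$, if for all $v\in\mathbb{R}^s$ with $(I-P^T)v=0$ the following conditions are satisfied: $$v^T(C-I)V_1\tilde{D}V_1^{-1}(c-e)^s=0,$$ $$v^T\left(c^j-jRE_2c^{j-1}\right)=0,\qquad j=2,\ldots,s+1.$$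
   Context: Problem: $u'(t)=F(u(t))$, $u(0)=u_0\in\mathbb{R}^m$, on a fixed bounded time interval, with $F:\mathbb{R}^m\to\mathbb{R}^m$ and the solution $u$ sufficiently smooth. Grid: step sizes $\triangle t_n>0$, $t_0=0$, $t_n=\triangle t_0+\ldots+\triangle t_{n-1}$, step size ratios $\sigma_n=\triangle t_n/\triangle t_{n-1}$ with $0\le\sigma_{min}<\sigma_n<\sigma_{max}$, and $\triangle t_{max}=\max_{i=0,\ldots,n}\triangle t_i$. All $\mathcal{O}$-constants are uniform in $n$ (for $t_n$ in the bounded time interval), in $i$ and in the step sizes, as $\triangle t_{max}\to 0$. Method: $w_n=[w_{n,1}^T,\ldots,w_{n,s}^T]^T\in\mathbb{R}^{ms}$ with $w_{n,i}\approx u(t_n+c_i\triangle t_n)$; the nodes $c_i\in\mathbb{R}$ are pairwise distinct and $c_s=1$; $F(w)=[F(w_i)]$ is applied componentwise. An $s\times s$ matrix $A$ acting on $\mathbb{R}^{ms}$ means $A\otimes I_m$. $P,R,E_2$ are constant $s\times s$ matrices, $R$ lower triangular with constant diagonal $r_{ii}=\gamma>0$, $E_2$ strictly lower triangular. The exact values are $w(t_n)=[u(t_n+c_i\triangle t_n)]_{i=1}^s$. Notation: $e=(1,\ldots,1)^T$, $c=(c_1,\ldots,c_s)^T$, powers of vectors are componentwise (with $0^0=1$), $V_0=(c_i^{j-1})_{i,j=1}^s$, $V_1=((c_i-1)^{j-1})_{i,j=1}^s$, $C=\mathrm{diag}(c_1,\ldots,c_s)$, $D=\mathrm{diag}(1,2,\ldots,s)$,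 $\tilde D=(s+1)D^{-1}-I$, $S_n=\mathrm{diag}(1,\sigma_n,\ldots,\sigma_n^{s-1})$. The matrices $Q_n$ and $E_{1,n}$ are $$Q_n=\left((CV_0-RV_0D)S_n-\tfrac{1}{\sigma_n}P(C-I)V_1\right)(V_1D)^{-1},\qquad E_{1,n}=(I-E_2)V_0S_nV_1^{-1}.$$ Defect coefficients: $$d_{n,j}=\frac{1}{j!}\left(c^j-\frac{1}{\sigma_n^j}P(c-e)^j-\frac{j}{\sigma_n^{j-1}}Q_n(c-e)^{j-1}-jRc^{j-1}\right),\qquad l_{n,j}=\frac{1}{j!}\left((I-E_2)c^j-\frac{1}{\sigma_n^j}E_{1,n}(c-e)^j\right).$$ The explicit method has stage order $s$ if it is pre-consistent ($Pe=e$) and $d_{n,j}+Rl_{n,j-1}=0$ for all $\sigma_n$ and $j=1,\ldots,s$ (with $Q_n=\left((CV_0-RV_0D)S_n-\tfrac{1}{\sigma_n}P(C-I)V_1\right)(V_1D)^{-1}$ and $E_{1,n}=(I-E_2)V_0S_nV_1^{-1}$ one has in fact $d_{n,j}=0$ and $l_{n,j-1}=0$ for $j=1,\ldots,s$). Standing stability assumption (with $K$ a constant independent of $n$ and the step sizes): products of the transfer matrices of the error recursion are bounded by $K$, in the sense that there is a fixed $\rho_0>0$ such that, for all sequences $\tilde w_i\in\mathbb{R}^{ms}$ with $\|\tilde w_i-w(t_i)\|\le\rho_0$ and residuals $\rho_i=\tilde w_i-P\tilde w_{i-1}-\triangle t_i(Q_i+RE_{1,i})F(\tilde w_{i-1})-\triangle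 t_iRE_2F(\tilde w_i)$, $i\ge 1$, one has $\|\tilde w_n-w_n\|\le K(\|\tilde w_0-w_0\|+\|\rho_1\|+\ldots+\|\rho_n\|)$. *)

(* Defs.v *)
From HB Require Import structures.
From mathcomp Require Import all_boot all_order all_algebra.
From mathcomp Require Import all_classical all_reals all_analysis.

Set Implicit Arguments.
Unset Strict Implicit.
Unset Printing Implicit Defensive.

Import Order.TTheory GRing.Theory Num.Theory.
Import numFieldNormedType.Exports.
Local Open Scope classical_set_scope.
Local Open Scope ring_scope.

(* A stage vector w = [w_1^T, ..., w_s^T]^T of R^(m s) is the s x m matrix    *)
(* whose i-th row is w_i, so that (A (x) I_m) w is the product A *m w.        *)
(* Ordinals start at 0: the entry (i, j) of V_0 is c_i ^+ j, not ^+ j.-1.     *)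
(* Norms `| _ | of vectors and stage vectors are the library's sup norms.     *)

Definition evec (R : realType) (s : nat) : 'cV[R]_s := const_mx 1.

Definition cpow (R : realType) (s : nat) (x : 'cV[R]_s) (j : nat) : 'cV[R]_s :=
  map_mx (fun a => a ^+ j) x.

Definition V0mx (R : realType) (s : nat) (c : 'cV[R]_s) : 'M[R]_s :=
  \matrix_(i < s, j < s) (c i 0 ^+ j).

Definition V1mx (R : realType) (s : nat) (c : 'cV[R]_s) : 'M[R]_s :=
  \matrix_(i < s, j < s) ((c i 0 - 1) ^+ j).

Definition Cmx (R : realType) (s : nat) (c : 'cV[R]_s) : 'M[R]_s :=
  diag_mx c^T.

Definition Dmx (R : realType) (s : nat) : 'M[R]_s :=
  diag_mx (\row_(j < s) j.+1%:R).

Definition Dtmx (R : realType) (s : nat) : 'M[R]_s :=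
  s.+1%:R *: invmx (Dmx R s) - 1%:M.

Definition Smx (R : realType) (s : nat) (sg : R) : 'M[R]_s :=
  diag_mx (\row_(j < s) (sg ^+ j)).

Definition Qmx (R : realType) (s : nat) (c : 'cV[R]_s) (P Rm : 'M[R]_s)
    (sg : R) : 'M[R]_s :=
  ((Cmx c *m V0mx c - Rm *m V0mx c *m Dmx R s) *m Smx s sg
     - sg^-1 *: (P *m (Cmx c - 1%:M) *m V1mx c))
  *m invmx (V1mx c *m Dmx R s).

Definition E1mx (R : realType) (s : nat) (c : 'cV[R]_s) (E2 : 'M[R]_s)
    (sg : R) : 'M[R]_s :=
  (1%:M - E2) *m V0mx c *m Smx s sg *m invmx (V1mx c).

(* For j = 0 the two terms with factor j vanish, so j.-1 is harmless. *)
Definition dcoef (R : realType) (s : nat) (c : 'cV[R]_s) (P Rm : 'M[R]_s)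
    (sg : R) (j : nat) : 'cV[R]_s :=
  (j`!%:R)^-1 *:
    (cpow c j
     - (sg ^+ j)^-1 *: (P *m cpow (c - evec R s) j)
     - (j%:R / sg ^+ j.-1) *: (Qmx c P Rm sg *m cpow (c - evec R s) j.-1)
     - j%:R *: (Rm *m cpow c j.-1)).

Definition lcoef (R : realType) (s : nat) (c : 'cV[R]_s) (E2 : 'M[R]_s)
    (sg : R) (j : nat) : 'cV[R]_s :=
  (j`!%:R)^-1 *:
    ((1%:M - E2) *m cpow c j
     - (sg ^+ j)^-1 *: (E1mx c E2 sg *m cpow (c - evec R s) j)).

(* The ratios sigma_n range over ]sgmin, sgmax[. *)
Definition stage_order_s (R : realType) (s : nat) (c : 'cV[R]_s)
    (P Rm E2 : 'M[R]_s) (sgmin sgmax : R) : Prop :=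
  P *m evec R s = evec R s /\
  forall (sg : R) (j : nat), sgmin < sg < sgmax -> (1 <= j <= s)%N ->
    dcoef c P Rm sg j + Rm *m lcoef c E2 sg j.-1 = 0.

Definition tgrid (R : realType) (dt : nat -> R) (n : nat) : R :=
  \sum_(i < n) dt i.

Definition sigma (R : realType) (dt : nat -> R) (n : nat) : R :=
  dt n / dt n.-1.

Definition rowF (R : realType) (s m : nat) (F : 'rV[R]_m -> 'rV[R]_m)
    (w : 'M[R]_(s, m)) : 'M[R]_(s, m) :=
  \matrix_(i < s) F (row i w).

Definition peer_rhs (R : realType) (s m : nat) (F : 'rV[R]_m -> 'rV[R]_m)
    (c : 'cV[R]_s) (P Rm E2 : 'M[R]_s) (dt : nat -> R)
    (w : nat -> 'M[R]_(s, m)) (n : nat) : 'M[R]_(s, m) :=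
  P *m w n.-1
  + dt n *: ((Qmx c P Rm (sigma dt n) + Rm *m E1mx c E2 (sigma dt n))
               *m rowF F (w n.-1))
  + dt n *: (Rm *m E2 *m rowF F (w n)).

(* A computation w_0, ..., w_n with step sizes dt_0, ..., dt_n; only these    *)
(* entries of the two sequences matter. The O-constants are uniform over a    *)
(* family (a set) of runs. A run carries its own current index n, so taking   *)
(* all the pairs (grid, n) as family gives uniformity in n along each grid.   *)
Record run (R : realType) (s m : nat) := Run {
  dt : nat -> R;
  nidx : nat;
  wnum : nat -> 'M[R]_(s, m) }.

Definition dtmax (R : realType) (s m : nat) (r : run R s m) : R :=
  \big[Num.max/0]_(i < (nidx r).+1) dt r i.

Definition peer_run (R : realType) (s m : nat) (F : 'rV[R]_m -> 'rV[R]_m)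
    (c : 'cV[R]_s) (P Rm E2 : 'M[R]_s) (sgmin sgmax T : R)
    (r : run R s m) : Prop :=
  [/\ forall i, (i <= nidx r)%N -> 0 < dt r i,
      forall i, (1 <= i <= nidx r)%N -> sgmin < sigma (dt r) i < sgmax,
      tgrid (dt r) (nidx r) <= T
    & forall i, (1 <= i <= nidx r)%N ->
        wnum r i = peer_rhs F c P Rm E2 (dt r) (wnum r) i].

(* The exact values w(t_n) = [u(t_n + c_i dt_n)]_i. *)
Definition wexact (R : realType) (s m : nat) (u : R -> 'rV[R]_m)
    (c : 'cV[R]_s) (dt : nat -> R) (n : nat) : 'M[R]_(s, m) :=
  \matrix_(i < s) u (tgrid dt n + c i 0 * dt n).

Definition err (R : realType) (s m : nat) (u : R -> 'rV[R]_m)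
    (c : 'cV[R]_s) (r : run R s m) (n : nat) : 'M[R]_(s, m) :=
  wexact u c (dt r) n - wnum r n.

Definition for_small_steps (R : realType) (s m : nat) (G : set (run R s m))
    (A : run R s m -> Prop) : Prop :=
  exists2 h0 : R, 0 < h0 & forall r, G r -> dtmax r <= h0 -> A r.

Definition unifO (R : realType) (s m : nat) (G : set (run R s m))
    (f g : run R s m -> R) : Prop :=
  exists C : R, for_small_steps G (fun r => `|f r| <= C * g r).

(* dt_(i-1) = (1 + O(dtmax)) dt_i for i = 1, ..., n, uniformly in i. *)
Definition smooth_steps (R : realType) (s m : nat) (G : set (run R s m)) :
    Prop :=
  exists C : R, for_small_steps G (fun r =>
    forall i, (1 <= i <= nidx r)%N ->
      exists2 delta : R, `|delta| <= C * dtmax r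
        & dt r i.-1 = (1 + delta) * dt r i).

Definition convergent_of_order (R : realType) (s m : nat)
    (u : R -> 'rV[R]_m) (c : 'cV[R]_s) (G : set (run R s m)) (p : nat) : Prop :=
  unifO G (fun r => `|err u c r (nidx r)|) (fun r => dtmax r ^+ p).

Definition stable (R : realType) (s m : nat) (F : 'rV[R]_m -> 'rV[R]_m)
    (u : R -> 'rV[R]_m) (c : 'cV[R]_s) (P Rm E2 : 'M[R]_s)
    (G : set (run R s m)) (K : R) : Prop :=
  exists2 rho0 : R, 0 < rho0 & for_small_steps G (fun r =>
    forall wt : nat -> 'M[R]_(s, m),
      (forall i, (i <= nidx r)%N -> `|wt i - wexact u c (dt r) i| <= rho0) ->
      `|wt (nidx r) - wnum r (nidx r)|
        <= K * (`|wt 0%N - wnum r 0%N|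
                + \sum_(1 <= i < (nidx r).+1)
                    `|wt i - peer_rhs F c P Rm E2 (dt r) wt i|)).

(* ||e_n|| <= K ||e_0|| + K (sum) max ||u^(s+1)|| + O(dtmax^(s+1)). *)
Definition error_estimate (R : realType) (s m : nat) (u : R -> 'rV[R]_m)
    (c : 'cV[R]_s) (P Rm E2 : 'M[R]_s) (G : set (run R s m)) (K : R) : Prop :=
  exists2 rem : run R s m -> R,
    unifO G rem (fun r => dtmax r ^+ s.+1) &
    forall r, G r ->
      `|err u c r (nidx r)|
        <= K * `|err u c r 0%N|
           + K * (\sum_(1 <= i < (nidx r).+1)
                    dt r i ^+ s.+1
                    * `|dcoef c P Rm (sigma (dt r) i) s.+1
                        + Rm *m lcoef c E2 (sigma (dt r) i) s|)
               * sup [set `|derive1n s.+1 u t| | t in `[0, tgrid (dt r) (nidx r)]]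
           + rem r.

(* The nodes t_n + c_i dt_n may leave the time interval [0, T], so u is a    *)
(* C^(s+2) solution on an open interval ]a, b[ around it; F is C^1.          *)
Definition smooth_on (R : realType) (m : nat) (k : nat) (a b : R)
    (u : R -> 'rV[R]_m) : Prop :=
  (forall j t, (j < k)%N -> t \in `]a, b[%R -> derivable (derive1n j u) t 1) /\
  (forall t, t \in `]a, b[%R -> {for t, continuous (derive1n k u)}).

Definition smoothF (R : realType) (m : nat) (F : 'rV[R]_m -> 'rV[R]_m) : Prop :=
  (forall x, differentiable F x) /\
  (forall v, continuous (fun x => 'D_v F x)).

Definition ode_on (R : realType) (m : nat) (F : 'rV[R]_m -> 'rV[R]_m)
    (a b : R) (u : R -> 'rV[R]_m) : Prop :=
  forall t, t \in `]a, b[%R -> is_derive t 1 u (F (u t)).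

(* Main.v *)
Require Import Defs.
From HB Require Import structures.
From mathcomp Require Import all_boot all_order all_algebra.
From mathcomp Require Import all_classical all_reals all_analysis.
From mathcomp Require Import ring lra.
Import Order.TTheory GRing.Theory Num.Theory.
Import numFieldNormedType.Exports.
Local Open Scope classical_set_scope.
Local Open Scope ring_scope.

(* The defect d_(n,s+1) + R l_(n,s) at constant step size (sigma = 1) is
   orthogonal to the kernel of I - P^T by the superconvergence conditions, hence
   equals (I - P) z for some z.  Replacing the exact values w(t_i) by
   w(t_i) - dt_i^(s+1) z u^(s+1)(t_i) turns the local defect into the difference
   P z (dt_(i-1)^(s+1) u^(s+1)(t_(i-1)) - dt_i^(s+1) u^(s+1)(t_i)), which on
   smoothly varying grids is dt_i O(dtmax^(s+1)).  The residuals of the corrected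
   values therefore sum up to O(dtmax^(s+1)), and the stability estimate bounds
   their distance to the numerical solution; the correction itself is
   O(dtmax^(s+1)). *)

Set Implicit Arguments.
Unset Strict Implicit.

(** * Sup norm estimates for matrices and their products *)

Section MatrixNorm.
Context {R : realType}.

Lemma ler_mx_entry p q (A : 'M[R]_(p, q)) i j : `|A i j| <= `|A|.
Proof.
by rewrite [leRHS]/Num.norm /= mx_normrE; exact: (le_bigmax _ _ (i, j)).
Qed.

Lemma mx_norm_le p q (A : 'M[R]_(p, q)) (B : R) :
  0 <= B -> (forall i j, `|A i j| <= B) -> `|A| <= B.
Proof.
move=> B0 AB; rewrite /Num.norm /= mx_normrE; exact: bigmax_le.
Qed.

Lemma mx_norm_mulmx p q r (A : 'M[R]_(p, q)) (B : 'M[R]_(q, r)) :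
  `|A *m B| <= q%:R * `|A| * `|B|.
Proof.
apply: mx_norm_le => [|i j]; first by rewrite !mulr_ge0.
rewrite mxE (le_trans (ler_norm_sum _ _ _))//.
apply: (@le_trans _ _ (\sum_(k < q) `|A| * `|B|)).
  by apply: ler_sum => k _; rewrite normrM ler_pM// ler_mx_entry.
by rewrite sumr_const card_ord -[leLHS]mulr_natl mulrA.
Qed.

Lemma mx_norm_rows p q (A : 'M[R]_(p, q)) (B : R) :
  0 <= B -> (forall i, `|row i A| <= B) -> `|A| <= B.
Proof.
move=> B0 AB; apply: mx_norm_le => // i j.
apply: le_trans (AB i); have := ler_mx_entry (row i A) 0 j.
by rewrite mxE.
Qed.

Lemma mx_norm_row p q (A : 'M[R]_(p, q)) i : `|row i A| <= `|A|.
Proof. by apply: mx_norm_le => // k j; rewrite mxE ler_mx_entry. Qed.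

End MatrixNorm.

(** * Taylor expansion of scalar functions with a remainder bound *)

Section Taylor.
Context {R : realType}.
Implicit Types (f : nat -> R -> R) (t x M : R).

(** The derivative is bounded only at points no farther from [t] than [x]. Thus a bound growing with
    [|y - t|] may be used, frozen at its value for [x]. *)
Lemma ler_norm_MVT (g dg : R -> R) (a b t x M : R) :
  (forall y, y \in `[a, b]%R -> is_derive y 1 g (dg y)) ->
  t \in `[a, b]%R -> x \in `[a, b]%R ->
  (forall y, y \in `[a, b]%R -> `|y - t| <= `|x - t| -> `|dg y| <= M) ->
  `|g x - g t| <= M * `|x - t|.
Proof.
move=> gd tab xab dM.
have gc y : y \in `[a, b]%R -> {for y, continuous g}.
  by move=> /gd dy; apply/differentiable_continuous/derivable1_diffP.
have in_ab y z w : y \in `[a, b]%R -> z \in `[a, b]%R -> w \in `[y, z]%R ->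
    w \in `[a, b]%R.
  by rewrite !in_itv/=; lra.
have wc y z : y \in `[a, b]%R -> z \in `[a, b]%R ->
    {within `[y, z], continuous g}.
  move=> yab zab; apply: continuous_in_subspaceT => w.
  by rewrite inE => wyz; apply/gc/(in_ab y z).
have [tx|xt] := leP t x.
- have [w wtx ->] := MVT_segment tx
    (fun y h => gd y (in_ab t x y tab xab (subset_itv_oo_cc h))) (wc _ _ tab xab).
  have wab : w \in `[a, b]%R := in_ab _ _ _ tab xab wtx.
  move: wtx; rewrite in_itv/= => /andP[tw wx].
  rewrite normrM; apply: ler_wpM2r; first exact: normr_ge0.
  by apply: (dM _ wab); rewrite !ger0_norm ?subr_ge0// lerB.
- have [w wtx E] := MVT_segment (ltW xt)
    (fun y h => gd y (in_ab x t y xab tab (subset_itv_oo_cc h))) (wc _ _ xab tab).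
  have wab : w \in `[a, b]%R := in_ab _ _ _ xab tab wtx.
  move: wtx; rewrite in_itv/= => /andP[xw wt].
  rewrite distrC E normrM [`|x - t|]distrC.
  apply: ler_wpM2r; first exact: normr_ge0.
  apply: (dM _ wab); rewrite distrC [`|x - t|]distrC.
  by rewrite !ger0_norm ?subr_ge0 ?(ltW xt)// lerB.
Qed.

Lemma is_derive_taylor_poly (d : nat -> R) t x n :
  is_derive x 1 (fun y => \sum_(j < n.+1) (y - t) ^+ j / j`!%:R * d j)
    (\sum_(j < n) (x - t) ^+ j / j`!%:R * d j.+1).
Proof.
elim: n => [|n ih].
  under eq_fun do rewrite big_ord1 expr0.
  by rewrite big_ord0; exact: is_derive_cst.
under eq_fun do rewrite big_ord_recr/=.
rewrite big_ord_recr/=; apply: is_deriveD.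
have -> : (fun y : R => (y - t) ^+ n.+1 / n.+1`!%:R * d n.+1) =
    (d n.+1 / n.+1`!%:R) \*: ((id - cst t) ^+ n.+1).
  by apply/funext => y; rewrite mulrAC -mulrA [LHS]mulrC /GRing.scale/= exprfctE.
apply: is_derive_eq; rewrite /GRing.scale /= ?subr0 factS natrM.
by field; rewrite pnatr_eq0 -lt0n fact_gt0/=.
Qed.

(** Induction on [n]: the remainder vanishes at [t], and its derivative is the remainder of one
    order less for the shifted family. Taking the successive derivatives as a family [f] makes this
    shift possible. Each mean value step is bounded crudely, hence no factor [1/n!]. *)
Lemma taylor_lagrange f (a b M : R) n :
  (forall j y, (j < n)%N -> y \in `[a, b]%R ->
     is_derive y 1 (f j) (f j.+1 y)) ->
  (forall y, y \in `[a, b]%R -> `|f n y| <= M) ->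
  forall t x, t \in `[a, b]%R -> x \in `[a, b]%R ->
  `|f 0%N x - \sum_(j < n) (x - t) ^+ j / j`!%:R * f j t| <= M * `|x - t| ^+ n.
Proof.
elim: n f => [|n ih] f fd fM t x tab xab.
  by rewrite big_ord0 subr0 expr0 mulr1 fM.
pose g y := f 0%N y - \sum_(j < n.+1) (y - t) ^+ j / j`!%:R * f j t.
pose dg y := f 1%N y - \sum_(j < n) (y - t) ^+ j / j`!%:R * f j.+1 t.
have gt0 : g t = 0.
  rewrite /g subrr big_ord_recl/= expr0 fact0 invr1 !mul1r big1 ?addr0 ?subrr//.
  by move=> j _; rewrite expr0n/= !mul0r.
have gd y : y \in `[a, b]%R -> is_derive y 1 g (dg y).
  move=> yab; apply: is_deriveB; first exact: fd.
  exact: (is_derive_taylor_poly (fun j => f j t)).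
have M0 : 0 <= M by apply: le_trans (fM _ tab).
rewrite -/(g x) -[g x]subr0 -gt0 exprSr mulrA.
apply: (ler_norm_MVT gd) => // y yab yx.
apply: le_trans (ih (fun j => f j.+1) _ _ t y tab yab) _ => //.
  by move=> j z jn; apply: fd.
by rewrite ler_wpM2l// lerXn2r.
Qed.

End Taylor.

(** * Uniform bounds for the solution on a compact interval *)

Section CompactBounds.
Context {R : realType}.

Lemma compact_continuous_bounded (T : topologicalType) (V : normedModType R)
    (A : set T) (f : T -> V) :
  compact A -> (forall x, A x -> {for x, continuous f}) ->
  exists2 M : R, 0 <= M & forall x, A x -> `|f x| <= M.
Proof.
move=> cA cf.
have fA : {within A, continuous f}.
  by apply: continuous_in_subspaceT => x /[!inE]; exact: cf.
have [M [_ fM]] := compact_bounded (continuous_compact fA cA).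
exists (`|M| + 1) => [|x Ax]; first by rewrite addr_ge0.
by apply: fM; [rewrite (le_lt_trans (ler_norm M))// ltrDl|exists x].
Qed.

(** On the closed subinterval all derivatives up to order [k] are continuous, hence bounded by a
    common [M]. In the sup norm the Taylor estimate reduces to the scalar one, entry by entry. *)
Lemma smooth_taylor (m k : nat) (u : R -> 'rV[R]_m) (a b a1 b1 : R) :
  smooth_on k a b u -> a < a1 -> b1 < b ->
  exists M : R, [/\ 0 <= M,
    forall j t, (j <= k)%N -> t \in `[a1, b1]%R -> `|derive1n j u t| <= M &
    forall i n t x, (i + n <= k)%N -> t \in `[a1, b1]%R ->
      x \in `[a1, b1]%R ->
      `|derive1n i u x
        - \sum_(j < n) ((x - t) ^+ j / j`!%:R) *: derive1n (i + j) u t|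
      <= M * `|x - t| ^+ n].
Proof.
move=> [du cu] aa1 b1b.
have sub t : t \in `[a1, b1]%R -> t \in `]a, b[%R.
  by rewrite !in_itv/= => /andP[a1t tb1]; rewrite (lt_le_trans aa1)//=
    (le_lt_trans tb1).
(* The bound beyond order [k] is the dummy value 0, so that a total family [Mj] can be chosen; its
   sum up to [k] dominates each member. *)
have cj j : exists M : R, 0 <= M /\ ((j <= k)%N ->
    forall t, t \in `[a1, b1]%R -> `|derive1n j u t| <= M).
  have [jk|] := leqP j k; last by exists 0.
  have [t /sub tab|M M0 uM] := compact_continuous_bounded
      (@segment_compact _ a1 b1) (_ : forall t, `[a1, b1]%classic t ->
        {for t, continuous (derive1n j u)}); last by exists M; split.
  move: jk; rewrite leq_eqVlt => /orP[/eqP->|jk]; first exact: cu.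
  by apply/differentiable_continuous/derivable1_diffP/du.
have [Mj Mjb] := choice cj.
have MjM j : (j <= k)%N -> Mj j <= \sum_(i < k.+1) Mj i.
  move=> jk; rewrite (bigD1 (Ordinal (jk : (j < k.+1)%N)))//= lerDl.
  by apply: sumr_ge0 => i _; have [] := Mjb i.
have M0 : 0 <= \sum_(i < k.+1) Mj i.
  by apply: sumr_ge0 => i _; have [] := Mjb i.
exists (\sum_(i < k.+1) Mj i); split => // [j t jk tab|i n t x ink tab xab].
  by apply: le_trans (MjM j jk); have [_ ->] := Mjb j.
apply: mx_norm_le => [|p q]; first by rewrite mulr_ge0 ?exprn_ge0.
rewrite (ord1 p) !mxE summxE; under eq_bigr do rewrite mxE.
have := @taylor_lagrange R (fun j y => derive1n (i + j) u y 0 q) a1 b1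
  (\sum_(i < k.+1) Mj i) n.
rewrite addn0 => /(_ _ _ t x tab xab) H.
apply: H => [j y jn yab|y yab].
    have dy : derivable (derive1n (i + j) u) y 1.
      by apply: du (sub _ yab); rewrite (leq_trans _ ink)// ltn_add2l.
    split; first exact: (derivable_mxP _ _ _).1 dy 0 q.
    by rewrite addnS derive1nS derive1E derive_mx// mxE.
  apply: le_trans (ler_mx_entry _ _ _) _.
  by apply: le_trans (MjM _ ink); have [_ ->] := Mjb (i + n)%N.
Qed.

End CompactBounds.

(** * Lipschitz continuity of the right-hand side on balls *)

Section Lipschitz.
Context {R : realType} {m : nat}.
Implicit Types (F : 'rV[R]_m -> 'rV[R]_m) (x y : 'rV[R]_m).

Lemma is_derive_line F x v (t : R) : differentiable F (x + t *: v) ->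
  is_derive t 1 (fun r : R => F (x + r *: v)) ('D_v F (x + t *: v)).
Proof.
move=> dF.
have E : (fun h : R => h^-1 *: (((fun r : R => F (x + r *: v)) \o shift t)
      (h *: (1 : R)) - F (x + t *: v))) =
    (fun h : R => h^-1 *: ((F \o shift (x + t *: v)) (h *: v)
      - F (x + t *: v))).
  apply/funext => h /=; congr (_ *: (F _ - _)).
  by rewrite scalerDl addrCA [h *: _]mulr1.
split; last by rewrite /derive E.
by rewrite /derivable E; exact: diff_derivable.
Qed.

(** The derivatives along the basis vectors are bounded on the compact ball, and linearity of the
    differential extends this to all directions. The ball is convex, so the mean value inequality
    applies along the segment from [x] to [y]. *)
Lemma smoothF_lipschitz F (B : R) : smoothF F ->
  exists2 L : R, 0 <= L &
    forall x y, `|x| <= B -> `|y| <= B -> `|F y - F x| <= L * `|y - x|.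
Proof.
move=> [dF cF].
pose A := [set x : 'rV[R]_m | `|x| <= B].
have cA : compact A.
  apply: bounded_closed_compact.
    exists B; split; first exact: num_real.
    by move=> M BM x /= xB; exact: le_trans (ltW BM).
  have -> : A = (fun x : 'rV[R]_m => `|x|) @^-1` [set r | r <= B] by [].
  apply: closed_comp => [x _|]; first exact: norm_continuous.
  exact: closed_le.
have cj (j : 'I_m) : exists M : R, 0 <= M /\
    (forall x, A x -> `|'D_(delta_mx 0 j) F x| <= M).
  have [x _|M M0 AM] := compact_continuous_bounded cA
    (_ : forall x, A x -> {for x, continuous (fun x => 'D_(delta_mx 0 j) F x)}).
    exact: cF.
  by exists M.
have [M AM] := choice cj.
have S0 : 0 <= \sum_j M j by apply: sumr_ge0 => j _; have [] := AM j.
have DF w z : A z -> `|'D_w F z| <= (\sum_j M j) * `|w|.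
  move=> Az; rewrite (deriveE _ (dF z)) [w in 'd F z w]row_sum_delta.
  rewrite linear_sum mulr_suml (le_trans (ler_norm_sum _ _ _))//.
  apply: ler_sum => j _; rewrite linearZ normrZ mulrC ler_pM//.
    by rewrite -deriveE//; have [_ ->] := AM j.
  exact: ler_mx_entry.
exists (\sum_j M j) => // x y xB yB.
apply: mx_norm_le => [|p q]; first by rewrite mulr_ge0.
rewrite (ord1 p) !mxE.
have in01 (t : R) : t \in `[0, 1]%R -> A (x + t *: (y - x)).
  rewrite in_itv/= => /andP[t0 t1]; rewrite /A/=.
  have -> : x + t *: (y - x) = (1 - t) *: x + t *: y.
    by rewrite scalerBl scalerBr scale1r addrA addrAC.
  rewrite (le_trans (ler_normD _ _))// !normrZ !ger0_norm ?subr_ge0//.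
  have -> : B = (1 - t) * B + t * B by ring.
  by rewrite lerD// ler_wpM2l// subr_ge0.
have := @ler_norm_MVT R (fun t => F (x + t *: (y - x)) 0 q)
  (fun t => 'D_(y - x) F (x + t *: (y - x)) 0 q) 0 1 0 1
  ((\sum_j M j) * `|y - x|).
rewrite scale1r scale0r addr0 [x + (y - x)]addrC subrK subr0 normr1 mulr1; apply.
- move=> t t01.
  have [dt vt] := @is_derive_line F x (y - x) t (dF _).
  split; first exact: (derivable_mxP _ _ _).1 dt 0 q.
  by rewrite -vt derive_mx// mxE.
- by rewrite in_itv/= lexx ler01.
- by rewrite in_itv/= lexx ler01.
- by move=> t t01 _; apply: le_trans (ler_mx_entry _ _ _) _; exact/DF/in01.
Qed.

End Lipschitz.

(** Fredholm alternative: the columns of the cokernel matrix of [A^T] lie in the kernel of [A^T], so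
    [g] is orthogonal to them, which places [g^T] in the row space of [A^T]. *)
Lemma orthogonal_kernel_image (K : fieldType) (n : nat) (A : 'M[K]_n)
    (g : 'cV[K]_n) :
  (forall v : 'cV[K]_n, A^T *m v = 0 -> v^T *m g = 0) ->
  exists z : 'cV[K]_n, g = A *m z.
Proof.
move=> Ag.
have /submxP[D gD] : (g^T <= A^T)%MS.
  rewrite submxE; apply/eqP/trmx_inj/row_matrixP => k.
  rewrite trmx_mul trmxK row_mul trmx0 row0 -tr_col; apply: Ag.
  by rewrite colE mulmxA mulmx_coker mul0mx.
by exists D^T; rewrite -[g]trmxK gD trmx_mul trmxK.
Qed.

(** * Dependence of the method's coefficients on the step size ratio near 1 *)

Section LipschitzAtOne.
Context {R : realType}.

(* The radius 1/2 keeps x away from 0, where negative powers blow up. *)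
Definition lip1 (V : normedModType R) (f : R -> V) : Prop :=
  exists2 C : R, 0 <= C &
    forall x, `|x - 1| <= 1 / 2 -> `|f x - f 1| <= C * `|x - 1|.

Lemma lip1_bounded (V : normedModType R) (f : R -> V) : lip1 f ->
  exists2 C : R, 0 <= C & forall x, `|x - 1| <= 1 / 2 -> `|f x| <= C.
Proof.
move=> [C C0 fC]; exists (`|f 1| + C); first by rewrite addr_ge0.
move=> x x1; rewrite -[f x](subrK (f 1)) addrC.
rewrite (le_trans (ler_normD _ _))// lerD2l (le_trans (fC x x1))//.
by rewrite ler_piMr// (le_trans x1)//; lra.
Qed.

Lemma lip1_cst (V : normedModType R) (v : V) : lip1 (fun=> v).
Proof. by exists 0 => // x _; rewrite subrr normr0 mul0r. Qed.

Lemma lip1_id : lip1 (id : R -> R).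
Proof. by exists 1 => // x _; rewrite mul1r. Qed.

Lemma lip1D (V : normedModType R) (f g : R -> V) :
  lip1 f -> lip1 g -> lip1 (fun x => f x + g x).
Proof.
move=> [C C0 fC] [D D0 gD]; exists (C + D); first exact: addr_ge0.
move=> x x1; rewrite opprD addrACA (le_trans (ler_normD _ _))// mulrDl.
by rewrite lerD ?fC ?gD.
Qed.

(** Product rule for differences, stated once so that it covers both scaling and matrix
    multiplication. *)
Lemma lip1_bilinear (U V W : normedModType R) (op : U -> V -> W) (k : R)
    (f : R -> U) (g : R -> V) :
  (forall u u' v, op (u - u') v = op u v - op u' v) ->
  (forall u v v', op u (v - v') = op u v - op u v') ->
  0 <= k -> (forall u v, `|op u v| <= k * `|u| * `|v|) ->
  lip1 f -> lip1 g -> lip1 (fun x => op (f x) (g x)).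
Proof.
move=> opl opr k0 opk lf lg.
have [B B0 gB] := lip1_bounded lg.
case: lf lg => C C0 fC [D D0 gD].
exists (k * C * B + k * `|f 1| * D); first by rewrite addr_ge0 ?mulr_ge0.
move=> x x1.
have -> : op (f x) (g x) - op (f 1) (g 1) =
    op (f x - f 1) (g x) + op (f 1) (g x - g 1).
  by rewrite opl opr addrA subrK.
rewrite (le_trans (ler_normD _ _))// mulrDl lerD//.
  rewrite (le_trans (opk _ _))// [leRHS]mulrAC; apply: ler_pM => //.
  - by rewrite mulr_ge0.
  - by rewrite -mulrA ler_wpM2l// fC.
  - exact: gB.
by rewrite (le_trans (opk _ _))// -[leRHS]mulrA ler_wpM2l ?mulr_ge0// gD.
Qed.

Lemma lip1Z (V : normedModType R) (f : R -> R) (g : R -> V) :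
  lip1 f -> lip1 g -> lip1 (fun x => f x *: g x).
Proof.
apply: (@lip1_bilinear _ _ _ _ 1) => // [u u' v|u v v'|u v].
- exact: scalerBl.
- exact: scalerBr.
- by rewrite normrZ mul1r.
Qed.

Lemma lip1_mulmx p q r (f : R -> 'M[R]_(p, q)) (g : R -> 'M[R]_(q, r)) :
  lip1 f -> lip1 g -> lip1 (fun x => f x *m g x).
Proof.
apply: (@lip1_bilinear _ _ _ _ q%:R) => // [u u' v|u v v'|u v].
- exact: mulmxBl.
- exact: mulmxBr.
- exact: mx_norm_mulmx.
Qed.

Lemma lip1N (V : normedModType R) (f : R -> V) : lip1 f -> lip1 (fun x => - f x).
Proof.
by move=> [C C0 fC]; exists C => // x x1; rewrite -opprD normrN fC.
Qed.

Lemma lip1B (V : normedModType R) (f g : R -> V) :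
  lip1 f -> lip1 g -> lip1 (fun x => f x - g x).
Proof. by move=> lf lg; apply/lip1D/lip1N. Qed.

Lemma lip1_sum (V : normedModType R) (I : Type) (r : seq I) (f : I -> R -> V) :
  (forall i, lip1 (f i)) -> lip1 (fun x => \sum_(i <- r) f i x).
Proof.
move=> lf; elim: r => [|i r ih].
  by under eq_fun do rewrite big_nil; exact: lip1_cst.
by under eq_fun do rewrite big_cons; exact: lip1D.
Qed.

Lemma lip1X (f : R -> R) n : lip1 f -> lip1 (fun x => f x ^+ n).
Proof.
move=> lf; elim: n => [|n ih].
  by under eq_fun do rewrite expr0; exact: lip1_cst.
by under eq_fun do rewrite exprS; exact: lip1Z.
Qed.

Lemma lip1_inv : lip1 (fun x : R => x^-1).
Proof.
exists 2 => // x x1.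
have x2 : 1 / 2 <= x by move: x1; rewrite ler_norml; lra.
have x0 : x != 0 by rewrite gt_eqF//; lra.
rewrite invr1 (_ : x^-1 - 1 = x^-1 * (1 - x)); last by field.
rewrite normrM distrC ler_wpM2r// ger0_norm ?invr_ge0; last by lra.
by rewrite -[2]invrK lef_pV2 ?posrE; lra.
Qed.

Lemma lip1_expV n : lip1 (fun x : R => (x ^+ n)^-1).
Proof.
by under eq_fun do rewrite -exprVn; exact/lip1X/lip1_inv.
Qed.

Variables (s : nat) (c : 'cV[R]_s) (P Rm E2 : 'M[R]_s).

Lemma lip1_Smx : lip1 (fun x => Smx s x).
Proof.
rewrite /Smx; under eq_fun do rewrite diag_mx_sum_delta.
apply: lip1_sum => i; apply: lip1Z; last exact: lip1_cst.
by under eq_fun do rewrite mxE; exact/lip1X/lip1_id.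
Qed.

Lemma lip1_Qmx : lip1 (fun x => Qmx c P Rm x).
Proof.
apply: lip1_mulmx; last exact: lip1_cst.
apply: lip1B; last by apply: lip1Z; [exact: lip1_inv|exact: lip1_cst].
by apply: lip1_mulmx; [exact: lip1_cst|exact: lip1_Smx].
Qed.

Lemma lip1_E1mx : lip1 (fun x => E1mx c E2 x).
Proof.
apply: lip1_mulmx; last exact: lip1_cst.
by apply: lip1_mulmx; [exact: lip1_cst|exact: lip1_Smx].
Qed.

Lemma lip1_dcoef j : lip1 (fun x => dcoef c P Rm x j).
Proof.
apply: lip1Z; first exact: lip1_cst.
apply: lip1B; last exact: lip1_cst.
apply: lip1B.
  apply: lip1B; first exact: lip1_cst.
  by apply: lip1Z; [exact: lip1_expV|exact: lip1_cst].
apply: lip1Z.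
  by apply: (@lip1Z R^o); [exact: lip1_cst|exact: lip1_expV].
by apply: lip1_mulmx; [exact: lip1_Qmx|exact: lip1_cst].
Qed.

Lemma lip1_lcoef j : lip1 (fun x => lcoef c E2 x j).
Proof.
apply: lip1Z; first exact: lip1_cst.
apply: lip1B; first exact: lip1_cst.
apply: lip1Z; first exact: lip1_expV.
by apply: lip1_mulmx; [exact: lip1_E1mx|exact: lip1_cst].
Qed.

End LipschitzAtOne.

(** * The leading defect at constant step size *)

Section LeadingDefect.
Context {R : realType} {s : nat}.
Variables (c : 'cV[R]_s) (P Rm E2 : 'M[R]_s).
Hypothesis c_inj : injective (fun i : 'I_s => c i 0).

(** Up to transposition this is the Vandermonde matrix of the distinct points [c_i - 1]. *)
Lemma V1mx_unit : V1mx c \in unitmx.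
Proof.
have -> : V1mx c = (Vandermonde s (c - evec R s)^T)^T.
  by apply/matrixP => i j; rewrite !mxE.
rewrite unitmx_tr unitmxE det_Vandermonde unitfE.
apply/prodf_neq0 => i _; apply/prodf_neq0 => j ij.
rewrite !mxE subr_eq0 (inj_eq (addIr _)).
by apply: contraTneq ij => /c_inj ->; rewrite ltnn.
Qed.

Lemma Dmx_unit : Dmx R s \in unitmx.
Proof.
rewrite unitmxE det_diag unitfE; apply/prodf_neq0 => j _.
by rewrite mxE pnatr_eq0.
Qed.

Lemma Smx1 : Smx s (1 : R) = 1%:M.
Proof.
apply/matrixP => i j; rewrite !mxE expr1n.
by case: eqP => // _; rewrite mulr0n.
Qed.

(** The coefficients of the polynomial of degree below [s] that interpolates [x^s] at the points
    [c_i - 1]. *)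
Variable alpha : 'cV[R]_s.
Hypothesis alphaE : V1mx c *m alpha = cpow (c - evec R s) s.

(** At ratio 1, [Smx] is the identity and both [Qmx] and [E1mx] act on [(c - e)^s] through [alpha].
    The terms in [Rm *m cpow c s] and in [Rm *m V0mx c] cancel; the two terms with [P] combine to
    the factor [(s+1) D^-1 - I], which is [Dtmx]. *)
Lemma leading_defect1 :
  (s.+1)`!%:R *: (dcoef c P Rm 1 s.+1 + Rm *m lcoef c E2 1 s) =
  (cpow c s.+1 - s.+1%:R *: (Rm *m E2 *m cpow c s))
  - s.+1%:R *: ((Cmx c *m V0mx c *m invmx (Dmx R s) - Rm *m E2 *m V0mx c)
                *m alpha)
  + P *m ((Cmx c - 1%:M) *m V1mx c *m Dtmx R s *m alpha).
Proof.
have QE : Qmx c P Rm 1 *m cpow (c - evec R s) s =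
    Cmx c *m V0mx c *m invmx (Dmx R s) *m alpha - Rm *m V0mx c *m alpha
    - P *m ((Cmx c - 1%:M) *m V1mx c *m invmx (Dmx R s) *m alpha).
  rewrite /Qmx Smx1 mulmx1 invr1 scale1r.
  have -> : invmx (V1mx c *m Dmx R s) = invmx (Dmx R s) *m invmx (V1mx c).
    have VD : V1mx c *m Dmx R s \in unitmx.
      by rewrite unitmx_mul V1mx_unit Dmx_unit.
    rewrite -[RHS](mulmxK VD) -(mulmxA (invmx (Dmx R s))) (mulKmx V1mx_unit).
    by rewrite mulVmx ?Dmx_unit// mul1mx.
  rewrite -[LHS]mulmxA -(mulmxA (invmx (Dmx R s))) -alphaE (mulKmx V1mx_unit).
  rewrite ![in LHS]mulmxBl -!mulmxA.
  by rewrite (mulKVmx Dmx_unit).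
have E1E : E1mx c E2 1 *m cpow (c - evec R s) s =
    V0mx c *m alpha - E2 *m V0mx c *m alpha.
  rewrite /E1mx Smx1 mulmx1 -[LHS]mulmxA -alphaE (mulKmx V1mx_unit).
  by rewrite !mulmxBl mul1mx.
have xE : cpow (c - evec R s) s.+1 = (Cmx c - 1%:M) *m V1mx c *m alpha.
  rewrite -mulmxA alphaE; apply/matrixP => i j.
  rewrite mulmxBl mul1mx /Cmx mul_diag_mx !mxE (ord1 j) exprS; ring.
have DtE (X : 'M[R]_s) : X *m Dtmx R s *m alpha =
    s.+1%:R *: (X *m invmx (Dmx R s) *m alpha) - X *m alpha.
  by rewrite /Dtmx mulmxBr mulmx1 mulmxBl -scalemxAr -scalemxAl.
have cE : (1%:M - E2) *m cpow c s = cpow c s - E2 *m cpow c s.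
  by rewrite mulmxBl mul1mx.
rewrite /dcoef /lcoef !expr1n invr1 !scale1r mulr1 -pred_Sn QE E1E xE DtE cE.
rewrite !(mulmxBl _ _ alpha) -scalemxAr !(mulmxBr Rm) (mulmxBr P) -scalemxAr.
rewrite !(mulmxA Rm).
move: (Rm *m E2 *m cpow c s) (Rm *m cpow c s) (cpow c s.+1) => t1 t2 t3.
move: (P *m (_ *m V1mx c *m alpha)) => p1; move: (P *m _) => p2.
move: (Rm *m E2 *m _ *m alpha) => r1; move: (Rm *m _ *m _) => r2.
move: (_ *m alpha) => r3.
have f0 : (s`!%:R : R) != 0 by rewrite pnatr_eq0 -lt0n fact_gt0.
apply/matrixP => i j; rewrite !mxE factS natrM; field.
by rewrite f0/= nat1r pnatr_eq0.
Qed.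

(** Since [v^T P = v^T], the term with [P] vanishes by the condition on [Dtmx]. Column [j] of the
    matrix in front of [alpha] is a multiple of the vector in the condition of index [j+1]. *)
Lemma leading_defect1_orthogonal (v : 'cV[R]_s) :
  (0 < s)%N -> (forall i : 'I_s, i.+1 = s -> c i 0 = 1) ->
  v^T *m P = v^T ->
  v^T *m ((Cmx c - 1%:M) *m V1mx c *m Dtmx R s *m alpha) = 0 ->
  (forall j, (2 <= j <= s.+1)%N ->
     v^T *m (cpow c j - j%:R *: (Rm *m E2 *m cpow c j.-1)) = 0) ->
  v^T *m (dcoef c P Rm 1 s.+1 + Rm *m lcoef c E2 1 s) = 0.
Proof.
move=> s0 cs vP vD vc.
have f0 : (s.+1`!%:R : R) != 0 by rewrite pnatr_eq0 -lt0n fact_gt0.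
apply: (scalerI f0); rewrite scalemxAr leading_defect1 scaler0.
rewrite mulmxDr mulmxBr vc ?ltnS ?s0 ?leqnn// sub0r (mulmxA v^T P) vP vD addr0.
rewrite -scalemxAr.
suff -> : v^T *m ((Cmx c *m V0mx c *m invmx (Dmx R s) - Rm *m E2 *m V0mx c)
    *m alpha) = 0 by rewrite scaler0 oppr0.
(* The conditions start at j = 2; the column j = 1 drops out because the row of
   V1 belonging to the node c_s = 1 is (1, 0, ..., 0). *)
have a0 : alpha (Ordinal s0) 0 = 0.
  have slt : (s.-1 < s)%N by rewrite prednK.
  have := congr1 (fun X : 'cV[R]_s => X (Ordinal slt) 0) alphaE.
  rewrite !mxE cs ?prednK//= subrr expr0n (gtn_eqF s0)/= => E0.
  rewrite -[RHS]E0 (bigD1 (Ordinal s0))//= !mxE /= cs ?prednK// subrr expr0.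
  rewrite mul1r big1 ?addr0// => k k0.
  rewrite mxE cs ?prednK// subrr expr0n.
  by rewrite -[(k : nat) == _]/(k == Ordinal s0) (negbTE k0) mul0r.
have V0E (j : 'I_s) : V0mx c *m delta_mx j 0 = cpow c j.
  by rewrite -colE; apply/matrixP => i k; rewrite (ord1 k) !mxE.
have DE (j : 'I_s) :
    invmx (Dmx R s) *m delta_mx j 0 = j.+1%:R^-1 *: delta_mx j (0 : 'I_1).
  have j1 : (j.+1%:R : R) != 0 by rewrite pnatr_eq0.
  apply: (can_inj (mulKmx Dmx_unit)); rewrite (mulKVmx Dmx_unit) -scalemxAr.
  apply/matrixP => i k; rewrite mul_diag_mx !mxE.
  by case: eqP => [->|_]; rewrite ?mulr0// mulrA mulVf// mul1r.
have colE1 (j : 'I_s) :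
    (Cmx c *m V0mx c *m invmx (Dmx R s) - Rm *m E2 *m V0mx c) *m delta_mx j 0 =
    j.+1%:R^-1 *: (cpow c j.+1 - j.+1%:R *: (Rm *m E2 *m cpow c j)).
  rewrite mulmxBl -(mulmxA _ (invmx _)) DE -scalemxAr -!(mulmxA _ (V0mx c)) V0E.
  rewrite scalerBr scalerA mulVf ?pnatr_eq0// scale1r; congr (_ *: _ - _).
  by apply/matrixP => i k; rewrite mul_diag_mx !mxE (ord1 k) exprS.
have -> : alpha = \sum_j alpha j 0 *: delta_mx j 0.
  by rewrite [LHS]matrix_sum_delta; apply: eq_bigr => j _; rewrite big_ord1.
rewrite mulmx_sumr mulmx_sumr big1// => j _.
rewrite -!scalemxAr colE1 -scalemxAr.
have [j0|j0] := posnP j; last by rewrite vc ?scaler0// !ltnS j0 ltnW.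
rewrite (_ : j = Ordinal s0) ?a0 ?scale0r//; exact: val_inj.
Qed.

End LeadingDefect.

(** * Taylor expansion of the residual of the exact solution *)

Section ExactResidual.
Context {R : realType} {s m : nat}.
Variables (c : 'cV[R]_s) (P Rm E2 : 'M[R]_s).

(** Free abscissae [x] allow one base point for both steps: the previous stages, with step [k], sit
    at [t_n + (c_i - 1) k]. *)
Definition stages (f : R -> 'rV[R]_m) (x : 'cV[R]_s) (t h : R) : 'M[R]_(s, m) :=
  \matrix_(i < s) f (t + x i 0 * h).

Definition Bmx (sg : R) : 'M[R]_s := Qmx c P Rm sg + Rm *m E1mx c E2 sg.

(* The coefficient of h^j u^(j) in the Taylor expansion of the residual of the
   exact solution. *)
Definition gcoef (sg : R) (j : nat) : 'cV[R]_s :=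
  dcoef c P Rm sg j + Rm *m lcoef c E2 sg j.-1.

Definition taylor_bound (k : nat) (u : R -> 'rV[R]_m) (a1 b1 M : R) : Prop :=
  forall i n t x, (i + n <= k)%N -> t \in `[a1, b1]%R -> x \in `[a1, b1]%R ->
    `|derive1n i u x
      - \sum_(j < n) ((x - t) ^+ j / j`!%:R) *: derive1n (i + j) u t|
    <= M * `|x - t| ^+ n.

Definition stages_taylor (u : R -> 'rV[R]_m) (x : 'cV[R]_s) (t h : R)
    (i n : nat) : 'M[R]_(s, m) :=
  \sum_(j < n) (h ^+ j / j`!%:R) *: (cpow x j *m derive1n (i + j) u t).

Lemma stages_taylorP k u a1 b1 M (x : 'cV[R]_s) t h i n :
  0 <= M -> taylor_bound k u a1 b1 M -> (i + n <= k)%N ->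
  t \in `[a1, b1]%R -> (forall p, t + x p 0 * h \in `[a1, b1]%R) ->
  `|stages (derive1n i u) x t h - stages_taylor u x t h i n|
    <= M * `|x| ^+ n * `|h| ^+ n.
Proof.
move=> M0 uM ink tab xab.
apply: mx_norm_rows => [|p]; first by rewrite !mulr_ge0// exprn_ge0.
have -> : row p (stages (derive1n i u) x t h - stages_taylor u x t h i n) =
    derive1n i u (t + x p 0 * h)
    - \sum_(j < n) ((t + x p 0 * h - t) ^+ j / j`!%:R) *: derive1n (i + j) u t.
  apply/matrixP => q r; rewrite !mxE (ord1 q) !summxE; congr (_ - _).
  apply: eq_bigr => j _; rewrite !mxE big_ord1 !mxE [t + _]addrC addrK exprMn.
  by rewrite mulrCA !mulrA.
apply: (le_trans (uM _ _ _ _ ink tab (xab p))).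
rewrite [t + _]addrC addrK normrM exprMn mulrA ler_wpM2r ?exprn_ge0//.
by rewrite ler_wpM2l// lerXn2r ?nnegrE// ler_mx_entry.
Qed.

(** Here [h / sg] is the previous step size. In [gcoef] the terms [Rm *m cpow c i] of the two
    defects cancel, leaving the one with [Rm *m E2]. *)
Lemma residual_term (sg h : R) i : sg != 0 ->
  (h ^+ i.+1 / i.+1`!%:R) *: cpow c i.+1
  - ((h / sg) ^+ i.+1 / i.+1`!%:R) *: (P *m cpow (c - evec R s) i.+1)
  - (h * ((h / sg) ^+ i / i`!%:R)) *: (Bmx sg *m cpow (c - evec R s) i)
  - (h * (h ^+ i / i`!%:R)) *: (Rm *m E2 *m cpow c i)
  = h ^+ i.+1 *: gcoef sg i.+1.
Proof.
move=> sg0.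
have cE : (1%:M - E2) *m cpow c i = cpow c i - E2 *m cpow c i.
  by rewrite mulmxBl mul1mx.
rewrite /gcoef /dcoef /lcoef -pred_Sn cE /Bmx mulmxDl -!scalemxAr !mulmxBr.
rewrite -!scalemxAr !mulmxA.
move: (Rm *m E2 *m cpow c i) (Rm *m cpow c i) (cpow c i.+1) => t1 t2 t3.
move: (Rm *m _ *m _) => t4; move: (P *m _) => t5; move: (_ *m cpow _ _) => t6.
have f0 : (i`!%:R : R) != 0 by rewrite pnatr_eq0 -lt0n fact_gt0.
apply/matrixP => p q; rewrite !mxE factS natrM !expr_div_n !exprS; field.
by rewrite sg0 expf_neq0// f0/= nat1r pnatr_eq0.
Qed.

(** Here [t] is the new grid point, [h] the step starting there and [k] the step leading to it. *)
Definition exact_residual (u : R -> 'rV[R]_m) (t h k : R) : 'M[R]_(s, m) :=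
  stages u c t h - P *m stages u (c - evec R s) t k
  - h *: (Bmx (h / k) *m stages (derive1n 1 u) (c - evec R s) t k)
  - h *: (Rm *m E2 *m stages (derive1n 1 u) c t h).

(* By the differential equation F(w) is the stage vector of u', so the residual
   is linear in u and can be expanded term by term. *)
Lemma exact_residual_taylor (u : R -> 'rV[R]_m) (t h k : R) :
  P *m evec R s = evec R s -> h != 0 -> k != 0 ->
  (forall j, (1 <= j <= s)%N -> gcoef (h / k) j = 0) ->
  stages_taylor u c t h 0 s.+2
  - P *m stages_taylor u (c - evec R s) t k 0 s.+2
  - h *: (Bmx (h / k) *m stages_taylor u (c - evec R s) t k 1 s.+1)
  - h *: (Rm *m E2 *m stages_taylor u c t h 1 s.+1)
  = h ^+ s.+1 *: (gcoef (h / k) s.+1 *m derive1n s.+1 u t).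
Proof.
move=> Pe h0 k0 gj.
have sg0 : h / k != 0 by rewrite mulf_neq0// invr_eq0.
have hsg : h / (h / k) = k by rewrite invf_div mulrC divfK.
have S0 (x : 'cV[R]_s) r : stages_taylor u x t r 0 s.+2 = evec R s *m u t +
    \sum_(i < s.+1) (r ^+ i.+1 / i.+1`!%:R) *:
      (cpow x i.+1 *m derive1n i.+1 u t).
  rewrite /stages_taylor big_ord_recl/= expr0 fact0 divr1 scale1r.
  by congr (_ *m _ + _); apply/matrixP => i j; rewrite !mxE expr0.
(* Pre-consistency cancels the terms of order 0; of the others only the one of order [s+1] survives
   the stage order. *)
rewrite !S0 /stages_taylor mulmxDr (mulmxA P) Pe opprD addrACA subrr add0r.
rewrite !mulmx_sumr.
rewrite !scaler_sumr -!sumrB.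
have E (i : 'I_s.+1) : h ^+ i.+1 *: (gcoef (h / k) i.+1 *m derive1n i.+1 u t) =
    (h ^+ i.+1 / i.+1`!%:R) *: (cpow c i.+1 *m derive1n i.+1 u t)
    - P *m ((k ^+ i.+1 / i.+1`!%:R) *:
        (cpow (c - evec R s) i.+1 *m derive1n i.+1 u t))
    - h *: (Bmx (h / k) *m ((k ^+ i / i`!%:R) *:
        (cpow (c - evec R s) i *m derive1n (1 + i) u t)))
    - h *: (Rm *m E2 *m ((h ^+ i / i`!%:R) *:
        (cpow c i *m derive1n (1 + i) u t))).
  rewrite scalemxAl -residual_term// hsg !mulmxBl -!scalemxAl -!scalemxAr.
  by rewrite !scalerA !(mulmxA _ (cpow _ _)).
under eq_bigr do rewrite -E.
rewrite big_ord_recr/= big1 ?add0r// => i _.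
by rewrite gj ?mul0mx ?scaler0//=.
Qed.

(** The stages of [u] are expanded to order [s+2], those of [u'] only to [s+1] because they carry a
    factor [h]. Powers of [k] are converted to powers of [h] by [k <= 2 * h]. *)
Lemma exact_residual_bound (u : R -> 'rV[R]_m) (a1 b1 M : R) :
  0 <= M -> taylor_bound s.+2 u a1 b1 M -> P *m evec R s = evec R s ->
  exists2 C : R, 0 <= C & forall t h k : R,
    0 < h -> 0 < k -> k <= 2 * h -> `|h / k - 1| <= 1 / 2 ->
    (forall j, (1 <= j <= s)%N -> gcoef (h / k) j = 0) ->
    t \in `[a1, b1]%R ->
    (forall p, t + c p 0 * h \in `[a1, b1]%R) ->
    (forall p, t + (c - evec R s) p 0 * k \in `[a1, b1]%R) ->
    `|exact_residual u t h k
      - h ^+ s.+1 *: (gcoef (h / k) s.+1 *m derive1n s.+1 u t)|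
    <= C * h ^+ s.+2.
Proof.
move=> M0 uM Pe.
have [Bb Bb0 BbP] : exists2 Bb : R, 0 <= Bb &
    forall x : R, `|x - 1| <= 1 / 2 -> `|Bmx x| <= Bb.
  apply/lip1_bounded/lip1D; first exact: lip1_Qmx.
  by apply: lip1_mulmx; [exact: lip1_cst|exact: lip1_E1mx].
pose e := `|c - evec R s|.
exists (M * `|c| ^+ s.+2 + s%:R * `|P| * (M * e ^+ s.+2 * 2 ^+ s.+2)
   + s%:R * Bb * (M * e ^+ s.+1 * 2 ^+ s.+1)
   + s%:R * `|Rm *m E2| * (M * `|c| ^+ s.+1)).
  by do ?[apply: addr_ge0|apply: exprn_ge0|apply: mulr_ge0] => //;
    exact: normr_ge0.
move=> t h k h0 k0 k2h hk1 gj tab cab ceab.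
rewrite -exact_residual_taylor ?gt_eqF// /exact_residual.
have T f (x : 'cV[R]_s) r q n :
    f = stages (derive1n q u) x t r -> (q + n <= s.+2)%N ->
    (forall p, t + x p 0 * r \in `[a1, b1]%R) -> 0 <= r ->
    `|f - stages_taylor u x t r q n| <= M * `|x| ^+ n * r ^+ n.
  move=> -> qn xab r0; rewrite -[in r ^+ n](ger0_norm r0).
  exact: (stages_taylorP M0 uM).
have := T _ c h 0%N s.+2 erefl (leqnn _) cab (ltW h0).
have := T _ _ k 0%N s.+2 erefl (leqnn _) ceab (ltW k0).
have := T _ c h 1%N s.+1 erefl (leqnn _) cab (ltW h0).
have := T _ _ k 1%N s.+1 erefl (leqnn _) ceab (ltW k0).
rewrite -/e.
(* Numbered from the last bound backwards: [W1], [W2] are stages of [u] and [W3], [W4] of [u']; the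
   even ones belong to the previous step. *)
set W4 := stages _ _ _ _; set S4 := stages_taylor _ _ _ _ _ _.
set W3 := stages _ _ _ _; set S3 := stages_taylor _ _ _ _ _ _.
set W2 := stages _ _ _ _; set S2 := stages_taylor _ _ _ _ _ _.
set W1 := stages _ _ _ _; set S1 := stages_taylor _ _ _ _ _ _.
move=> H4 H3 H2 H1.
have -> : W1 - P *m W2 - h *: (Bmx (h / k) *m W4) - h *: (Rm *m E2 *m W3) -
    (S1 - P *m S2 - h *: (Bmx (h / k) *m S4) - h *: (Rm *m E2 *m S3)) =
    (W1 - S1) - P *m (W2 - S2) - h *: (Bmx (h / k) *m (W4 - S4))
    - h *: (Rm *m E2 *m (W3 - S3)).
  rewrite !mulmxBr.
  move: (P *m W2) (P *m S2) => p1 p2.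
  move: (Bmx (h / k) *m W4) (Bmx (h / k) *m S4) => p3 p4.
  move: (Rm *m E2 *m W3) (Rm *m E2 *m S3) => p5 p6.
  by apply/matrixP => p q; rewrite !mxE; ring.
have kn n : k ^+ n <= 2 ^+ n * h ^+ n.
  by rewrite -exprMn lerXn2r// nnegrE ?mulr_ge0 ?ltW.
have e0 : 0 <= e by exact: normr_ge0.
have h0' := ltW h0.
have Me n : 0 <= M * e ^+ n by rewrite mulr_ge0// exprn_ge0.
have B1 : `|P *m (W2 - S2)| <=
    s%:R * `|P| * (M * e ^+ s.+2 * 2 ^+ s.+2) * h ^+ s.+2.
  rewrite (le_trans (mx_norm_mulmx _ _))// -[leRHS]mulrA ler_wpM2l ?mulr_ge0//.
  by rewrite (le_trans H2)// -[leRHS]mulrA ler_wpM2l ?kn ?Me.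
have B2 : `|h *: (Bmx (h / k) *m (W4 - S4))| <=
    s%:R * Bb * (M * e ^+ s.+1 * 2 ^+ s.+1) * h ^+ s.+2.
  rewrite normrZ (ger0_norm h0') [h ^+ _]exprS [leRHS]mulrCA ler_wpM2l//.
  rewrite (le_trans (mx_norm_mulmx _ _))// -[leRHS]mulrA ler_pM ?mulr_ge0//.
    by rewrite ler_wpM2l// BbP.
  by rewrite (le_trans H4)// -[leRHS]mulrA ler_wpM2l ?kn ?Me.
have B3 : `|h *: (Rm *m E2 *m (W3 - S3))| <=
    s%:R * `|Rm *m E2| * (M * `|c| ^+ s.+1) * h ^+ s.+2.
  rewrite normrZ (ger0_norm h0') [h ^+ _]exprS [leRHS]mulrCA ler_wpM2l//.
  by rewrite (le_trans (mx_norm_mulmx _ _))// -[leRHS]mulrA ler_wpM2l ?mulr_ge0.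
rewrite !mulrDl.
rewrite (le_trans (ler_normB _ _))// lerD//.
rewrite (le_trans (ler_normB _ _))// lerD//.
by rewrite (le_trans (ler_normB _ _))// lerD.
Qed.

End ExactResidual.

(** * Grid points and sums of step sizes *)

Section Grid.
Context {R : realType}.
Variables (dt : nat -> R) (n : nat).
Hypothesis dt_gt0 : forall i, (i <= n)%N -> 0 < dt i.

Lemma tgridS i : tgrid dt i.+1 = tgrid dt i + dt i.
Proof. by rewrite /tgrid big_ord_recr. Qed.

Lemma tgrid_ge0 i : (i <= n)%N -> 0 <= tgrid dt i.
Proof.
move=> ni; apply: sumr_ge0 => j _; apply/ltW/dt_gt0.
by rewrite (leq_trans (ltnW (ltn_ord j))).
Qed.

Lemma tgrid_le i : (i <= n)%N -> tgrid dt i <= tgrid dt n.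
Proof.
move=> ni; rewrite /tgrid -!(big_mkord xpredT dt).
rewrite (big_cat_nat (leq0n i) ni)//= lerDl.
by rewrite big_nat_cond; apply: sumr_ge0 => j /andP[/andP[_ /ltnW jn] _];
  exact/ltW/dt_gt0.
Qed.

(** The grid point [t_n] contains the steps 0 to [n-1] only, hence the additional [dt n]. *)
Lemma sum_steps_le : \sum_(1 <= i < n.+1) dt i <= tgrid dt n + dt n.
Proof.
rewrite -tgridS /tgrid -(big_mkord xpredT dt).
rewrite [leRHS](big_cat_nat (leq0n 1) (ltn0Sn n))//=.
by rewrite lerDr big_nat1 ltW// dt_gt0.
Qed.

End Grid.

Lemma ler_norm_subX (R : realDomainType) (x y e : R) n :
  0 <= x <= e -> 0 <= y <= e ->
  `|x ^+ n.+1 - y ^+ n.+1| <= n.+1%:R * e ^+ n * `|x - y|.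
Proof.
move=> /andP[x0 xe] /andP[y0 ye]; rewrite subrXX normrM mulrC.
rewrite ler_wpM2r// (le_trans (ler_norm_sum _ _ _))//.
apply: (@le_trans _ _ (\sum_(i < n.+1) e ^+ n)); last first.
  by rewrite sumr_const card_ord -[leLHS]mulr_natl.
apply: ler_sum => i _; rewrite normrM !normrX !ger0_norm//.
have -> : e ^+ n = e ^+ (n.+1.-1 - i) * e ^+ i.
  by rewrite -exprD subnK// -ltnS.
have e0 : 0 <= e by exact: le_trans xe.
by rewrite ler_pM ?exprn_ge0// lerXn2r.
Qed.

(** * Residual of the corrected exact values *)

Section PerturbedResidual.
Context {R : realType} {s m : nat}.
Variables (F : 'rV[R]_m -> 'rV[R]_m) (u : R -> 'rV[R]_m).
Variables (c : 'cV[R]_s) (P Rm E2 : 'M[R]_s) (z : 'cV[R]_s).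
Variables (a1 b1 M L Cs : R).
Hypothesis M0 : 0 <= M.
Hypothesis L0 : 0 <= L.
Hypothesis uM : taylor_bound s.+2 u a1 b1 M.
Hypothesis u_le : forall j t, (j <= s.+2)%N -> t \in `[a1, b1]%R ->
  `|derive1n j u t| <= M.
Hypothesis u_ode : forall t, t \in `[a1, b1]%R -> derive1n 1 u t = F (u t).
Hypothesis F_lip : forall x y, `|x| <= M + 1 -> `|y| <= M + 1 ->
  `|F y - F x| <= L * `|y - x|.
Hypothesis Pe : P *m evec R s = evec R s.
Hypothesis zE : gcoef c P Rm E2 1 s.+1 = z - P *m z.

(* Since z - P z is the leading defect at ratio 1, subtracting h^(s+1) z u^(s+1)
   cancels that defect in the residual up to one more order in the step size. *)
Definition corrected (dt : nat -> R) (n : nat) : 'M[R]_(s, m) :=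
  wexact u c dt n - dt n ^+ s.+1 *: (z *m derive1n s.+1 u (tgrid dt n)).

Lemma corrected_dist (dt : nat -> R) n : 0 <= dt n ->
  tgrid dt n \in `[a1, b1]%R ->
  `|corrected dt n - wexact u c dt n| <= `|z| * M * dt n ^+ s.+1.
Proof.
move=> dt0 tab; rewrite /corrected addrAC subrr add0r normrN normrZ.
rewrite ger0_norm ?exprn_ge0// mulrC ler_wpM2r ?exprn_ge0//.
by rewrite (le_trans (mx_norm_mulmx _ _))// mul1r ler_wpM2l// u_le.
Qed.

(** The exact stages are bounded by [M] and the correction by 1, so both arguments stay in the ball
    of radius [M + 1] on which [F] is Lipschitz. *)
Lemma rowF_corrected_dist (dt : nat -> R) n : 0 <= dt n ->
  tgrid dt n \in `[a1, b1]%R ->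
  (forall p, tgrid dt n + c p 0 * dt n \in `[a1, b1]%R) ->
  `|z| * M * dt n ^+ s.+1 <= 1 ->
  `|rowF F (corrected dt n) - rowF F (wexact u c dt n)|
    <= L * (`|z| * M * dt n ^+ s.+1).
Proof.
move=> dt0 tab pab small; have d := corrected_dist dt0 tab.
have rowd p : `|row p (corrected dt n) - row p (wexact u c dt n)| <=
    `|z| * M * dt n ^+ s.+1.
  by rewrite -linearB/= (le_trans (mx_norm_row _ _)).
have wM p : `|row p (wexact u c dt n)| <= M.
  by rewrite rowK; exact: (@u_le 0).
apply: mx_norm_rows => [|p]; first by rewrite !mulr_ge0// exprn_ge0.
have rF w : row p (rowF F w) = F (row p w) by rewrite rowK.
rewrite linearB/= !rF (le_trans (F_lip _ _)) ?ler_wpM2l//.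
  by rewrite (le_trans (wM p))// lerDl.
rewrite -[row _ _](subrK (row p (wexact u c dt n))).
rewrite (le_trans (ler_normD _ _))//.
by rewrite addrC lerD// (le_trans (rowd p)).
Qed.

Lemma corrected_residual_bound :
  exists2 C : R, 0 <= C & forall (dt : nat -> R) (i : nat) (eta d : R),
    (0 < i)%N -> 0 < dt i <= eta -> 0 < dt i.-1 <= eta -> eta <= 1 ->
    dt i.-1 = (1 + d) * dt i -> `|d| <= Cs * eta -> Cs * eta <= 1 / 3 ->
    `|z| * M * eta <= 1 ->
    (forall j, (1 <= j <= s)%N -> gcoef c P Rm E2 (sigma dt i) j = 0) ->
    tgrid dt i \in `[a1, b1]%R -> tgrid dt i.-1 \in `[a1, b1]%R ->
    (forall p, tgrid dt i + c p 0 * dt i \in `[a1, b1]%R) ->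
    (forall p, tgrid dt i.-1 + c p 0 * dt i.-1 \in `[a1, b1]%R) ->
    `|corrected dt i - peer_rhs F c P Rm E2 dt (corrected dt) i|
      <= C * (dt i * eta ^+ s.+1).
Proof.
have [C1 C10 C1P] := exact_residual_bound c Rm E2 M0 uM Pe.
have [Bb Bb0 BbP] : exists2 Bb : R, 0 <= Bb &
    forall x : R, `|x - 1| <= 1 / 2 -> `|Bmx c P Rm E2 x| <= Bb.
  apply/lip1_bounded/lip1D; first exact: lip1_Qmx.
  by apply: lip1_mulmx; [exact: lip1_cst|exact: lip1_E1mx].
have [Cg Cg0 CgP] : lip1 (fun x : R => gcoef c P Rm E2 x s.+1).
  apply: lip1D; first exact: lip1_dcoef.
  by apply: lip1_mulmx; [exact: lip1_cst|exact: lip1_lcoef].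
(* One constant per source: [C1] for the Taylor remainder, [C2] for the deviation of the ratio from
   1, [C3] for the change of the correction over one step (of [u^(s+1)] and of the step size power),
   [C4] and [C5] for the correction inside [F]. *)
pose C2 := Cg * (3 / 2 * `|Cs|) * M.
pose C3 := `|P *m z| * (2 * M + s.+1%:R * `|Cs| * M).
pose C4 := s%:R * Bb * (L * (`|z| * M)).
pose C5 := s%:R * `|Rm *m E2| * (L * (`|z| * M)).
exists (C1 + C2 + C3 + C4 + C5).
  by do ?[apply: addr_ge0|apply: mulr_ge0] => //; exact: normr_ge0.
move=> dt i eta d i0 /andP[h0 hle] /andP[k0 kle] eta1 kE dle dle3 small gj.
move=> tab tab' pab pab'.
set h := dt i in h0 hle kE *; set k := dt i.-1 in k0 kle kE *.
set t := tgrid dt i in tab pab *; set t' := tgrid dt i.-1 in tab' pab' *.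
have tE : t = t' + k.
  by rewrite /t -(prednK i0) tgridS.
have eta0 : 0 < eta by exact: lt_le_trans hle.
have d3 : `|d| <= 1 / 3 by exact: le_trans dle3.
have dC : `|d| <= `|Cs| * eta.
  by rewrite (le_trans dle)// ler_wpM2r ?ler_norm// ltW.
(* The ratio is [1 / (1 + d)]; with [|d| <= 1/3] it differs from 1 by at most [3/2 |d| <= 1/2], the
   radius in [lip1]. *)
have d1 : 2 / 3 <= 1 + d by move: d3; rewrite ler_norml; lra.
have k2h : k <= 2 * h.
  by rewrite kE ler_wpM2r ?(ltW h0)//; move: d3; rewrite ler_norml; lra.
have sgE : h / k - 1 = - d / (1 + d).
  by rewrite kE; field; rewrite (gt_eqF h0) andbT gt_eqF//; lra.
have sg1 : `|h / k - 1| <= 3 / 2 * `|d|.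
  rewrite sgE normrM normrN mulrC ler_wpM2r//.
  rewrite ger0_norm ?invr_ge0; last by lra.
  by rewrite -[3 / 2]invrK lef_pV2 ?posrE; lra.
have sg2 : `|h / k - 1| <= 1 / 2 by lra.
have hsig : sigma dt i = h / k by [].
have zk (x : R) : 0 <= x <= eta ->
    `|z| * M * x ^+ s.+1 <= `|z| * M * eta ^+ s.+1.
  move=> /andP[x0 xe]; rewrite ler_wpM2l ?mulr_ge0// lerXn2r ?nnegrE//.
  exact: le_trans xe.
have zs : `|z| * M * eta ^+ s.+1 <= 1.
  rewrite (le_trans _ small)// ler_wpM2l ?mulr_ge0// exprS ler_piMr ?(ltW eta0)//.
  by rewrite exprn_ile1// ltW.
have heta : 0 <= h <= eta by rewrite ltW.
have keta : 0 <= k <= eta by rewrite ltW.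
have W : wexact u c dt i = stages u c t h by [].
have W' : wexact u c dt i.-1 = stages u (c - evec R s) t k.
  apply/row_matrixP => p; rewrite !rowK; congr u.
  by rewrite !mxE tE /t' /k; ring.
have FW : rowF F (wexact u c dt i) = stages (derive1n 1 u) c t h.
  by apply/row_matrixP => p; rewrite !rowK u_ode.
have pab2 p : t + (c - evec R s) p 0 * k \in `[a1, b1]%R.
  rewrite (_ : _ + _ = t' + c p 0 * k) ?pab'//.
  by rewrite !mxE tE; ring.
have FW' : rowF F (wexact u c dt i.-1) =
    stages (derive1n 1 u) (c - evec R s) t k.
  by rewrite W'; apply/row_matrixP => p; rewrite !rowK u_ode.
set U := derive1n s.+1 u t; set U' := derive1n s.+1 u t'.
set X1 := exact_residual c P Rm E2 u t h k - h ^+ s.+1 *: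
  (gcoef c P Rm E2 (h / k) s.+1 *m U).
set X2 := h ^+ s.+1 *:
  ((gcoef c P Rm E2 (h / k) s.+1 - gcoef c P Rm E2 1 s.+1) *m U).
set X3 := P *m z *m (k ^+ s.+1 *: (U' - U) + (k ^+ s.+1 - h ^+ s.+1) *: U).
set X4 := h *: (Bmx c P Rm E2 (h / k) *m
  (rowF F (corrected dt i.-1) - rowF F (wexact u c dt i.-1))).
set X5 := h *: (Rm *m E2 *m
  (rowF F (corrected dt i) - rowF F (wexact u c dt i))).
(* Beyond the defect at ratio 1, equal to [z - P z] by [zE], the correction contributes
   [- h^(s+1) z U + k^(s+1) P z U']; the terms in [z U] cancel and [X3] remains. *)
have -> : corrected dt i - peer_rhs F c P Rm E2 dt (corrected dt) i =
    X1 + X2 + X3 - X4 - X5.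
  rewrite /X1 /X2 /X3 /X4 /X5 zE /peer_rhs hsig -/(Bmx c P Rm E2 (h / k)).
  rewrite /exact_residual -W -W' -FW -FW'.
  have -> : P *m corrected dt i.-1 = P *m wexact u c dt i.-1
      - k ^+ s.+1 *: (P *m z *m U').
    by rewrite mulmxBr -scalemxAr mulmxA.
  rewrite {1}/corrected -/h -/t -/U !(mulmxBr, mulmxBl, mulmxDr) -!scalemxAr.
  rewrite !mulmxBr.
  move: (Bmx _ _ _ _ _ *m rowF F (wexact _ _ _ _)) (Bmx _ _ _ _ _ *m _) => p1 p2.
  move: (Rm *m E2 *m rowF F (wexact _ _ _ _)) (Rm *m E2 *m _) => p3 p4.
  move: (P *m z *m U) (P *m z *m U') (P *m _) (z *m U) (_ *m U) => p5 p6 p7 p8 p9.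
  by apply/matrixP => p q; rewrite !mxE; ring.
have X1P : `|X1| <= C1 * (h * eta ^+ s.+1).
  apply: (le_trans (C1P _ _ _ h0 k0 k2h sg2 gj tab pab pab2)).
  rewrite ler_wpM2l// [h ^+ _]exprS ler_wpM2l ?(ltW h0)//.
  by rewrite lerXn2r ?nnegrE ?(ltW h0) ?(ltW eta0).
have hs : h ^+ s <= eta ^+ s by rewrite lerXn2r ?nnegrE ?(ltW h0) ?(ltW eta0).
have X2P : `|X2| <= C2 * (h * eta ^+ s.+1).
  have -> : C2 * (h * eta ^+ s.+1) =
      h * eta ^+ s * (Cg * (3 / 2 * (`|Cs| * eta)) * M).
    by rewrite /C2 exprS; ring.
  rewrite normrZ ger0_norm ?exprn_ge0 ?(ltW h0)// [h ^+ _]exprS ler_pM//.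
  - by rewrite mulr_ge0 ?exprn_ge0// ltW.
  - by rewrite ler_wpM2l// ltW.
  rewrite (le_trans (mx_norm_mulmx _ _))// mul1r ler_pM//.
    rewrite (le_trans (CgP _ sg2))// ler_wpM2l// (le_trans sg1)//.
    by rewrite ler_wpM2l// divr_ge0.
  exact: u_le.
(* The first order Taylor bound for [u^(s+1)], using derivatives up to order [s+2]. *)
have UU : `|U' - U| <= M * k.
  have := uM (i := s.+1) (n := 1) (eq_leq (addn1 s.+1)) tab tab'.
  rewrite big_ord1 expr0 fact0 divr1 scale1r addn0 expr1 => /le_trans; apply.
  by rewrite tE opprD addNKr normrN ger0_norm// ltW.
have X3P : `|X3| <= C3 * (h * eta ^+ s.+1).
  rewrite (le_trans (mx_norm_mulmx _ _))// mul1r -mulrA ler_wpM2l//.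
  rewrite (le_trans (ler_normD _ _))// mulrDl !normrZ lerD//.
    rewrite ger0_norm ?exprn_ge0 ?(ltW k0)//.
    have -> : 2 * M * (h * eta ^+ s.+1) = eta ^+ s.+1 * (M * (2 * h)) by ring.
    rewrite ler_pM ?exprn_ge0 ?(ltW k0)//.
      by rewrite lerXn2r ?nnegrE ?(ltW k0) ?(ltW eta0).
    by rewrite (le_trans UU)// ler_wpM2l.
  have -> : s.+1%:R * `|Cs| * M * (h * eta ^+ s.+1) =
      s.+1%:R * eta ^+ s * (`|Cs| * eta * h) * M by rewrite exprS; ring.
  rewrite ler_pM//; last exact: u_le.
  rewrite (le_trans (ler_norm_subX _ keta heta))// ler_wpM2l//.
    by rewrite mulr_ge0 ?exprn_ge0// ltW.
  have -> : k - h = d * h by rewrite kE; ring.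
  by rewrite normrM [`|h|]ger0_norm ?ler_wpM2r// ltW.
have X45 (B : 'M[R]_s) (b : R) (W1 W2 : 'M[R]_(s, m)) : `|B| <= b ->
    `|W1 - W2| <= L * (`|z| * M * eta ^+ s.+1) ->
    `|h *: (B *m (W1 - W2))| <= s%:R * b * (L * (`|z| * M)) * (h * eta ^+ s.+1).
  move=> Bbd Wd.
  have -> : s%:R * b * (L * (`|z| * M)) * (h * eta ^+ s.+1) =
      h * (s%:R * b * (L * (`|z| * M * eta ^+ s.+1))) by ring.
  rewrite normrZ ger0_norm ?(ltW h0)// ler_wpM2l ?(ltW h0)//.
  rewrite (le_trans (mx_norm_mulmx _ _))// ler_pM ?mulr_ge0//.
  by rewrite ler_wpM2l.
have X4P : `|X4| <= C4 * (h * eta ^+ s.+1).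
  apply: X45; first exact: BbP.
  have zk' := zk _ keta.
  rewrite (le_trans (rowF_corrected_dist _ tab' pab' _)) ?(ltW k0)//.
    exact: le_trans zk' zs.
  by rewrite ler_wpM2l.
have X5P : `|X5| <= C5 * (h * eta ^+ s.+1).
  apply: X45 => //; have zh := zk _ heta.
  rewrite (le_trans (rowF_corrected_dist _ tab pab _)) ?(ltW h0)//.
    exact: le_trans zh zs.
  by rewrite ler_wpM2l.
rewrite !mulrDl (le_trans (ler_normB _ _))// lerD//.
rewrite (le_trans (ler_normB _ _))// lerD//.
rewrite (le_trans (ler_normD _ _))// lerD//.
by rewrite (le_trans (ler_normD _ _))// lerD.
Qed.

End PerturbedResidual.

(** * Convergence from stability and the corrected values *)

Unset Implicit Arguments.
Set Strict Implicit.

Theorem theorem2p4 (R : realType) (m s : nat)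
  (* the initial value problem, on the time interval [0, T] *)
  (F : 'rV[R]_m -> 'rV[R]_m) (u0 : 'rV[R]_m) (u : R -> 'rV[R]_m) (a b T : R)
  (ha : a < 0) (hT : 0 < T) (hb : T < b)
  (hF : smoothF F) (hu : smooth_on s.+2 a b u)
  (hode : ode_on F a b u) (hu0 : u 0 = u0)
  (* the method *)
  (hs : (0 < s)%N)
  (c : 'cV[R]_s) (P Rm E2 : 'M[R]_s) (gamma : R)
  (hc : injective (fun i : 'I_s => c i 0))
  (hcs : forall i : 'I_s, i.+1 = s -> c i 0 = 1)
  (hRlow : forall i j : 'I_s, (i < j)%N -> Rm i j = 0)
  (hRdiag : forall i : 'I_s, Rm i i = gamma) (hgamma : 0 < gamma)
  (hE2 : forall i j : 'I_s, (i <= j)%N -> E2 i j = 0)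
  (sgmin sgmax : R) (hsg : 0 <= sgmin)
  (horder : stage_order_s c P Rm E2 sgmin sgmax)
  (* the family of grids and numerical solutions *)
  (G : set (run R s m))
  (hG : forall r, G r -> peer_run F c P Rm E2 sgmin sgmax T r)
  (K : R)
  (hstab : stable F u c P Rm E2 G K)
  (hest : error_estimate u c P Rm E2 G K)
  (hinit : unifO G (fun r => `|err u c r 0%N|) (fun r => dt r 0%N ^+ s.+1))
  (hsteps : smooth_steps G)
  (* the superconvergence conditions *)
  (hsuper : forall v : 'cV[R]_s, (1%:M - P^T) *m v = 0 ->
     v^T *m ((Cmx c - 1%:M) *m V1mx c *m Dtmx R s *m invmx (V1mx c)
              *m cpow (c - evec R s) s) = 0
     /\ forall j : nat, (2 <= j <= s.+1)%N ->
          v^T *m (cpow c j - j%:R *: (Rm *m E2 *m cpow c j.-1)) = 0) :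
  convergent_of_order u c G s.+1.
Proof.
(* A compact interval inside []a, b[] that still exceeds [[0, T]] on both sides, leaving room for
   the nodes [t_n + c_i dt_n]. *)
have [a1a bb1] : a < a / 2 /\ (b + T) / 2 < b by split; lra.
have [M [M0 uM uT]] := smooth_taylor hu a1a bb1.
have sub t : t \in `[a / 2, (b + T) / 2]%R -> t \in `]a, b[%R.
  by rewrite !in_itv/=; lra.
have uF t : t \in `[a / 2, (b + T) / 2]%R -> derive1n 1 u t = F (u t).
  by move=> /sub tab; rewrite derive1n1 derive1E; have [] := hode t tab.
have [L L0 FL] := smoothF_lipschitz (M + 1) hF.
have [Pe hord] := horder.
have [z zE] : exists z : 'cV[R]_s, gcoef c P Rm E2 1 s.+1 = (1%:M - P) *m z.
  apply: orthogonal_kernel_image => v.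
  rewrite linearB/= trmx1 => vP; have [v1 v2] := hsuper v vP.
  (* Here [alpha] is [invmx (V1mx c)] applied to [(c - e)^s], as in the first superconvergence
     condition. *)
  apply: (leading_defect1_orthogonal hc (mulKVmx (V1mx_unit hc) _)) => //.
    move/eqP: vP; rewrite mulmxBl mul1mx subr_eq0 => /eqP/(congr1 trmx).
    by rewrite trmx_mul trmxK.
  by rewrite (mulmxA (_ *m Dtmx R s)).
rewrite mulmxBl mul1mx in zE.
have [Cs [h1 h10 hs1]] := hsteps.
have [C0 [h2 h20 hi2]] := hinit.
have [rho rho0 [h3 h30 hst]] := hstab.
have [C C00 CP] := corrected_residual_bound Cs M0 L0 uT uM uF FL Pe zE.
pose zM := `|z| * M; have zM0 : 0 <= zM by rewrite mulr_ge0.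
have [dd dd0 [dda ddb]] : exists2 dd : R, 0 < dd &
    dd <= - a / 2 /\ dd <= (b - T) / 2.
  exists (Num.min (- a / 2) ((b - T) / 2)).
    by rewrite lt_min; apply/andP; split; lra.
  by rewrite !ge_min !lexx orbT.
(* Step size thresholds: [h4] keeps the nodes in the compact interval, [h5] gives [Cs * eta <= 1/3],
   [h6] keeps the correction below 1 and within the stability radius [rho]. The summand 1 makes the
   denominators positive. *)
pose h4 := dd / (1 + `|c|); pose h5 := (1 / 3) / (1 + `|Cs|).
pose h6 := Num.min 1 rho / (1 + zM).
have c1 : 0 < 1 + `|c| by rewrite ltr_pwDl.
have Cs1 : 0 < 1 + `|Cs| by rewrite ltr_pwDl.
have zM1 : 0 < 1 + zM by rewrite ltr_pwDl.
(* Stability multiplies the initial error [|C0|], the initial correction [zM] and the summed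
   residuals; [T + 1] bounds [t_n + dt_n]. The last [zM] is the correction at the final index. *)
exists (`|K| * ((`|C0| + zM) + C * (T + 1)) + zM).
exists (Num.min 1 (Num.min (Num.min h1 h2)
  (Num.min h3 (Num.min h4 (Num.min h5 h6))))).
  by rewrite !lt_min ltr01 h10 h20 h30 !divr_gt0// lt_min ltr01.
move=> r Gr; rewrite !le_min.
set eta := dtmax r.
move=> /and5P[eta1 /andP[etah1 etah2] etah3 etah4 /andP[etah5 etah6]].
have [dt0 dtsg tT _] := hG r Gr.
set n := nidx r in dt0 dtsg tT *.
have dtle i : (i <= n)%N -> dt r i <= eta.
  move=> ni.
  exact: (le_bigmax 0 (fun i : 'I_n.+1 => dt r i) (Ordinal (ni : (i < n.+1)%N))).
have eta0 : 0 < eta by rewrite (lt_le_trans (dt0 0%N _))// dtle.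
have ceta : `|c| * eta <= dd.
  move: etah4; rewrite ler_pdivlMr// mulrDr mulr1 => /(le_trans _); apply.
  by rewrite mulrC lerDr ltW.
have Cseta : Cs * eta <= 1 / 3.
  move: etah5; rewrite ler_pdivlMr// mulrDr mulr1 => /(le_trans _); apply.
  apply: (@le_trans _ _ (eta * `|Cs|)); last by rewrite lerDr ltW.
  by rewrite mulrC ler_wpM2l ?ler_norm// ltW.
have [zeta1 zetarho] : zM * eta <= 1 /\ zM * eta <= rho.
  have : zM * eta <= Num.min 1 rho.
    move: etah6; rewrite ler_pdivlMr// mulrDr mulr1 => /(le_trans _); apply.
    by rewrite mulrC lerDr ltW.
  by rewrite le_min => /andP[].
have etaS : eta ^+ s.+1 <= eta.
  by rewrite exprS ler_piMr ?(ltW eta0)// exprn_ile1// ltW.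
have tab i : (i <= n)%N -> tgrid (dt r) i \in `[a / 2, (b + T) / 2]%R.
  move=> ni; have := tgrid_ge0 dt0 ni; have := tgrid_le dt0 ni.
  by rewrite in_itv/=; lra.
have pab i : (i <= n)%N -> forall p,
    tgrid (dt r) i + c p 0 * dt r i \in `[a / 2, (b + T) / 2]%R.
  move=> ni p; have ti0 := tgrid_ge0 dt0 ni; have tin := tgrid_le dt0 ni.
  have : `|c p 0 * dt r i| <= dd.
    rewrite normrM (le_trans _ ceta)// ler_pM ?ler_mx_entry//.
    by rewrite gtr0_norm ?dt0 ?dtle.
  by rewrite ler_norml in_itv/=; lra.
have cdist i : (i <= n)%N ->
    `|corrected u c z (dt r) i - wexact u c (dt r) i| <= zM * eta ^+ s.+1.
  move=> ni; rewrite (le_trans (corrected_dist c z uM (ltW (dt0 i ni)) (tab i ni)))//.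
  by rewrite ler_wpM2l// lerXn2r ?nnegrE ?(ltW eta0) ?(ltW (dt0 _ _)) ?dtle.
have res : \sum_(1 <= i < n.+1) `|corrected u c z (dt r) i
      - peer_rhs F c P Rm E2 (dt r) (corrected u c z (dt r)) i|
    <= C * (T + 1) * eta ^+ s.+1.
  apply: (@le_trans _ _ (\sum_(1 <= i < n.+1) C * (dt r i * eta ^+ s.+1))).
    rewrite big_nat_cond [leRHS]big_nat_cond.
    apply: ler_sum => i /andP[/andP[i1 ni] _].
    have ni' : (i.-1 <= n)%N by rewrite (leq_trans (leq_pred _)).
    have ini : (1 <= i <= n)%N by rewrite i1.
    have [d dC dE] := hs1 r Gr etah1 i ini.
    apply: (CP _ _ eta d) => //.
    - by rewrite dt0// dtle.
    - by rewrite dt0// dtle.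
    - by move=> j js; apply: hord => //; exact: dtsg.
    - exact: tab.
    - exact: tab.
    - exact: pab.
    - exact: pab.
  rewrite -mulr_sumr -mulr_suml -mulrA ler_wpM2l// ler_wpM2r ?exprn_ge0 ?(ltW eta0)//.
  by rewrite (le_trans (sum_steps_le dt0))// lerD// (le_trans (dtle n _)).
have e0 : `|err u c r 0| <= `|C0| * eta ^+ s.+1.
  have := hi2 r Gr etah2; rewrite normr_id => /le_trans; apply.
  apply: le_trans (ler_wpM2r _ (ler_norm C0)) _.
    by rewrite exprn_ge0 ?(ltW (dt0 _ _)).
  by rewrite ler_wpM2l// lerXn2r ?nnegrE ?(ltW eta0) ?(ltW (dt0 _ _)) ?dtle.
have wdist : `|corrected u c z (dt r) n - wnum r n| <=
    `|K| * ((`|C0| + zM + C * (T + 1)) * eta ^+ s.+1).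
  apply: le_trans (hst r Gr etah3 (corrected u c z (dt r)) _) _.
    move=> i ni; rewrite (le_trans (cdist i ni))// (le_trans _ zetarho)//.
    by rewrite ler_wpM2l.
  apply: le_trans (ler_wpM2r _ (ler_norm K)) _.
    by rewrite addr_ge0// sumr_ge0.
  (* The initial distance is split at the exact values into the initial correction and the initial
     error. *)
  rewrite ler_wpM2l// mulrDl lerD// -(subrKA (wexact u c (dt r) 0)) mulrDl addrC.
  by rewrite (le_trans (ler_normD _ _))// lerD// cdist.
rewrite normr_id mulrDl -mulrA.
have -> : err u c r n = (corrected u c z (dt r) n - wnum r n)
    - (corrected u c z (dt r) n - wexact u c (dt r) n).
  by rewrite opprB [RHS]addrC subrKA.
by rewrite (le_trans (ler_normB _ _))// lerD// cdist.
Qed.
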